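(* Let $a>0$, $\lambda\in\mathbb{R}$, let $(\gamma_n)_{n\ge0}$ be i.i.d. random variables with law $GIG(\lambda,a,a)$, and for $n\ge1$ let $$Z_n=\sum_{k=0}^{n-1}\Big(\prod_{i=0}^{k-1}\gamma_i^{-1}\Big)\Big(\prod_{j=k+1}^{n-1}\gamma_j\Big).$$ Then the process $(Z_n)_{n\ge1}$ is a homogeneous Markov chain starting from $Z_1=1$ with transition kernel given, for $x>0$, by $$Q(x,dy)=\frac{1}{2K_\lambda(a^2)}\,\frac{K_\lambda\left(\frac{a^2}{y}\right)}{K_\lambda\left(\frac{a^2}{x}\right)}\,\frac1y\,e^{-\frac{a^2(x^2+y^2+1)}{2xy}}\,\mathbf{1}_{(0,+\infty)}(y)\,dy.$$
   Context: Empty products equal $1$. For $a>0$ and $\lambda\in\mathbb{R}$, $GIG(\lambda,a,a)$ (Generalized Inverse Gaussian) is the probability law on $(0,+\infty)$ with density $x\mapsto \frac{1}{2K_\lambda(a^2)}x^{\lambda-1}e^{-\frac{a^2}{2}(x+\frac1x)}$, where $K_\lambda(z)=\frac12\int_0^{+\infty}x^{\lambda-1}e^{-\frac z2(x+\frac1x)}dx$ for $z>0$ is the Macdonald function. *)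

(* Defs.v *)
From HB Require Import structures.
From mathcomp Require Import all_boot all_order all_algebra.
From mathcomp Require Import all_classical all_reals all_analysis.
From mathcomp Require Import measurable_realfun.
Set Implicit Arguments.
Unset Strict Implicit.
Unset Printing Implicit Defensive.
Import Order.TTheory GRing.Theory Num.Theory.
Import numFieldNormedType.Exports.
Local Open Scope classical_set_scope.
Local Open Scope ring_scope.

(* The product rule over every finite subfamily. *)
Definition mutually_independent (d d' : measure_display) (T : measurableType d)
    (T' : measurableType d') (R : realType) (P : probability T R)
    (X : nat -> T -> T') : Prop :=
  forall (s : seq nat) (A : nat -> set T'), uniq s ->
    (forall i, measurable (A i)) ->
    P (\bigcap_(i in [set` s]) (X i @^-1` A i)) =
    (\prod_(i <- s) P (X i @^-1` A i))%E.

Definition macdonald (R : realType) (lambda z : R) : R :=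
  2^-1 * Rintegral (@lebesgue_measure R) `]0, +oo[
    (fun x => x `^ (lambda - 1) * expR (- (z / 2) * (x + x^-1))).

Definition gig_density (R : realType) (lambda a x : R) : R :=
  (2 * macdonald lambda (a ^+ 2))^-1 *
  (x `^ (lambda - 1) * expR (- (a ^+ 2 / 2) * (x + x^-1))).

(* The law GIG(lambda, a, a), as a set function on the Borel sets of R. *)
Definition gig (R : realType) (lambda a : R) (A : set R) : \bar R :=
  (\int[@lebesgue_measure R]_(x in A `&` `]0%R, +oo[)
     (gig_density lambda a x)%:E)%E.

(* The value of Z_0 (an empty sum) plays no role. *)
Definition Zproc (T : Type) (R : realType) (gamma : nat -> T -> R) (n : nat)
    (w : T) : R :=
  \sum_(0 <= k < n)
    (\prod_(0 <= i < k) (gamma i w)^-1) * (\prod_(k.+1 <= j < n) gamma j w).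

(* q x A stands for the mass given to A by q(x, dy). The set D is the state
   space, seen as a measurable subset of the ambient space X; the values q x A
   for x outside D are irrelevant. *)
Definition transition_kernel_on (d : measure_display) (X : measurableType d)
    (R : realType) (D : set X) (q : X -> set X -> \bar R) : Prop :=
  (forall x, D x -> exists2 mu : probability X R,
     mu D = 1%E & forall A, measurable A -> q x A = mu A) /\
  (forall A, measurable A -> measurable_fun D (q ^~ A)).

(* The sigma-algebra sigma(X_1, ..., X_n). *)
Definition past (d d' : measure_display) (T : measurableType d)
    (X : measurableType d') (Z : nat -> T -> X) (n : nat) : set (set T) :=
  <<s \bigcup_(i in [set i | (1 <= i <= n)%N])
        preimage_set_system setT (Z i) measurable >>.

(* (Z_n)_{n >= 1} is a homogeneous Markov chain on the state space D, with
   transition kernel q, for its natural filtration: q(Z_n, A) is a version of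
   the conditional probability P(Z_{n+1} \in A | Z_1, ..., Z_n). The chain is
   only required to lie in D almost surely, hence the restriction of the
   integral to the event {Z_n \in D}, where q(Z_n, A) makes sense. *)
Definition homogeneous_markov_chain (d d' : measure_display)
    (T : measurableType d) (X : measurableType d') (R : realType)
    (P : probability T R) (D : set X) (q : X -> set X -> \bar R)
    (Z : nat -> T -> X) : Prop :=
  [/\ measurable D,
      transition_kernel_on D q,
      forall n, (1 <= n)%N -> measurable_fun setT (Z n),
      forall n, (1 <= n)%N -> P (Z n @^-1` D) = 1%E &
      forall n, (1 <= n)%N -> forall (E : set T) (A : set X),
        past Z n E -> measurable A ->
        P (E `&` Z n.+1 @^-1` A) =
        (\int[P]_(w in E `&` Z n @^-1` D) q (Z n w) A)%E].

Definition Qdensity (R : realType) (lambda a x y : R) : R :=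
  (2 * macdonald lambda (a ^+ 2))^-1 *
  (macdonald lambda (a ^+ 2 / y) / macdonald lambda (a ^+ 2 / x)) *
  y^-1 * expR (- (a ^+ 2 * (x ^+ 2 + y ^+ 2 + 1) / (2 * x * y))).

Definition Qkernel (R : realType) (lambda a x : R) (A : set R) : \bar R :=
  (\int[@lebesgue_measure R]_(y in A `&` `]0%R, +oo[)
     (Qdensity lambda a x y)%:E)%E.

(* Main.v *)
(* Put W_n = gamma_0 ... gamma_(n-1). Then Z_(n+1) = gamma_n Z_n + 1 / W_n and
   W_(n+1) = W_n gamma_n, so (Z_n, W_n) is a Markov chain. The point is that the
   conditional law of W_n given Z_1, ..., Z_n depends on Z_n = x only: it has a
   density proportional to w^(lambda-1) exp(-(a^2/(2x)) (w + 1/w)), whose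
   normalization is 2 K_lambda(a^2/x). For n = 1 this is the law of gamma_0. For
   the induction, the change of variables y = g x + 1/w, v = w g turns
     g^(lambda-1) e^(-(a^2/2)(g + 1/g)) w^(lambda-1) e^(-(a^2/(2x))(w + 1/w)) dg dw
   into
     y^-1 e^(-a^2(x^2+y^2+1)/(2xy)) v^(lambda-1) e^(-(a^2/(2y))(v + 1/v)) dy dv,
   which gives both the conditional law at time n+1 and the transition density
   Q(x, y). The same identity for x = 1, integrated, shows that K_lambda is
   finite at a^2/y for almost every y, hence everywhere by monotonicity, as soon
   as it is finite at a^2. *)
Require Import Defs.
From HB Require Import structures.
From mathcomp Require Import all_boot all_order all_algebra.
From mathcomp Require Import all_classical all_reals all_analysis.
From mathcomp Require Import measurable_realfun.
From mathcomp Require Import ring.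
Set Implicit Arguments.
Unset Strict Implicit.
Unset Printing Implicit Defensive.
Import Order.TTheory GRing.Theory Num.Theory.
Import numFieldNormedType.Exports.
Local Open Scope classical_set_scope.
Local Open Scope ring_scope.

(** * Measurability of inversion *)

Lemma measurable_invr (R : realType) : measurable_fun [set: R] (@GRing.inv R).
Proof.
(* Real powers are measurable. Squaring makes the base nonnegative, and at 0 both sides vanish since
   [0^-1 = 0]. *)
have -> : @GRing.inv R = fun x => x * (x ^+ 2) `^ (-1).
  apply/funext => x; rewrite powR_inv1 ?sqr_ge0//.
  have [->|x0] := eqVneq x 0; first by rewrite invr0 mul0r.
  by rewrite expr2 invfM mulrA divff// mul1r.
apply: measurable_funM => //.
by apply: (measurableT_comp (measurable_powR (-1))).
Qed.

Lemma measurable_funV d (T : measurableType d) (R : realType) (f : T -> R) :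
  measurable_fun setT f -> measurable_fun setT (fun x => (f x)^-1).
Proof. by move=> mf; apply: (measurableT_comp (@measurable_invr R) mf). Qed.

(** * Measures given by a density *)

Section density_measure.
Local Open Scope ereal_scope.
Context d (T : measurableType d) (R : realType) (mu : {measure set T -> \bar R}).
Context (h : T -> \bar R) (mh : measurable_fun setT h) (h0 : forall x, 0 <= h x).

(** The proofs of measurability and nonnegativity are arguments so that the measure structure
    declared below can be inferred from the term itself. *)
Definition density_measure (_ : measurable_fun setT h) (_ : forall x, 0 <= h x)
  (A : set T) : \bar R := \int[mu]_(x in A) h x.

Local Notation nu := (density_measure mh h0).

Let density_measure0 : nu set0 = 0.
Proof. by rewrite /density_measure integral_set0. Qed.

Let density_measure_ge0 A : 0 <= nu A.
Proof. by rewrite /density_measure integral_ge0. Qed.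

Let density_measure_sigma_additive : semi_sigma_additive nu.
Proof. exact: semi_sigma_additive_nng_induced. Qed.

HB.instance Definition _ := isMeasure.Build _ _ _ nu
  density_measure0 density_measure_ge0 density_measure_sigma_additive.

End density_measure.

Section integral_density.
Local Open Scope ereal_scope.
Context d (T : measurableType d) (R : realType).
Context (mu nu : {measure set T -> \bar R}) (h : T -> R).
Hypotheses (mh : measurable_fun setT h) (h0 : forall x, (0 <= h x)%R).
Hypothesis nuE : forall A, measurable A -> nu A = \int[mu]_(x in A) (h x)%:E.

Import HBNNSimple.

(** A simple function is a finite sum of multiples of indicators of its level sets, and on each
    level set the claim is [nuE]. *)
Let integral_density_nnsfun (f : {nnsfun T >-> R}) :
  \int[nu]_x (f x)%:E = \int[mu]_x ((f x)%:E * (h x)%:E).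
Proof.
have fE x : (f x)%:E = \sum_(y \in range f) (y * \1_(f @^-1` [set y]) x)%:E.
  by rewrite fsumEFin//= -fimfunE.
have y0 (y : R) x : 0 <= (y * \1_(f @^-1` [set y]) x)%:E.
  exact: nnfun_muleindic_ge0.
under eq_integral do rewrite fE.
rewrite ge0_integral_fsum//; last first.
  by move=> y; apply/measurable_EFinP; exact: measurable_funM.
under [RHS]eq_integral.
  move=> x _; rewrite fE ge0_mule_fsuml//.
  over.
rewrite ge0_integral_fsum//; last 2 first.
- move=> y; apply: emeasurable_funM; apply/measurable_EFinP => //.
  exact: measurable_funM.
- by move=> y x _; apply: mule_ge0; rewrite ?lee_fin//; exact: y0.
apply: eq_fsbigr => y; rewrite inE => -[x _ fxy].
have y_ge0 : (0 <= y)%R by rewrite -fxy.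
have mI : measurable (f @^-1` [set y]) by [].
under eq_integral do rewrite EFinM.
rewrite ge0_integralZl//; last exact/measurable_EFinP.
rewrite integral_indic// setIT.
under [RHS]eq_integral do rewrite EFinM -muleA.
rewrite ge0_integralZl//; last 2 first.
- by apply: emeasurable_funM; exact/measurable_EFinP.
- by move=> z _; rewrite mule_ge0 ?lee_fin.
rewrite nuE// integral_mkcond; congr (_ * _); apply: eq_integral => z _.
by rewrite patchE indicE; case: ifP => _; rewrite ?mul1e ?mul0e.
Qed.

(** Monotone convergence along a nondecreasing sequence of simple functions, applied on both
    sides. *)
Lemma integral_density (f : T -> \bar R) :
  measurable_fun setT f -> (forall x, 0 <= f x) ->
  \int[nu]_x f x = \int[mu]_x (f x * (h x)%:E).
Proof.
move=> mf f0; pose g := nnsfun_approx measurableT mf.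
have gcvg x : (g n x)%:E @[n --> \oo] --> f x.
  by apply: cvg_nnsfun_approx.
have gnd x : {homo (fun n => (g n x)%:E) : m n / (m <= n)%N >-> m <= n}.
  by move=> m n mn; rewrite lee_fin; exact/lefP/nd_nnsfun_approx.
transitivity (limn (fun n => \int[nu]_x (g n x)%:E)).
  rewrite -monotone_convergence//.
  - by apply: eq_integral => x _; apply/esym/cvg_lim.
  - by move=> n; exact/measurable_EFinP.
  - by move=> n x _; rewrite lee_fin.
transitivity (limn (fun n => \int[mu]_x ((g n x)%:E * (h x)%:E))).
  by congr (limn _); apply/funext => n; exact: integral_density_nnsfun.
rewrite -monotone_convergence//.
- apply: eq_integral => x _; apply/cvg_lim => //.
  exact: cvgeZr.
- by move=> n; apply: emeasurable_funM; exact/measurable_EFinP.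
- by move=> n x _; rewrite mule_ge0 ?lee_fin.
- by move=> x _ m n mn; apply: lee_wpmul2r; [rewrite lee_fin|exact: gnd].
Qed.

End integral_density.

(** * Tonelli's theorem on a product of subsets *)

Section fubini_on.
Local Open Scope ereal_scope.
Context d1 d2 (T1 : measurableType d1) (T2 : measurableType d2) (R : realType).
Context (m1 : {sigma_finite_measure set T1 -> \bar R}).
Context (m2 : {sigma_finite_measure set T2 -> \bar R}).
Context (A : set T1) (B : set T2) (mA : measurable A) (mB : measurable B).
Context (f : T1 * T2 -> \bar R).
Hypotheses (mf : measurable_fun setT f) (f0 : forall z, 0 <= f z).

Lemma measurable_fun_integral_on :
  measurable_fun setT (fun x => \int[m2]_(y in B) f (x, y)).
Proof.
rewrite (_ : (fun _ => _) =
    fun x => \int[m2]_y (f \_ (setT `*` B)) (x, y)); last first.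
  apply/funext => x; rewrite integral_mkcond; apply: eq_integral => y _.
  by rewrite !patchE in_setX in_setT.
apply: measurable_fun_fubini_tonelli_F => [|z].
  apply/measurable_restrict; [exact: measurableX|by []|].
  exact: measurable_funTS.
by rewrite patchE; case: ifP.
Qed.

(** Extending [f] by 0 outside [A] times [B] turns both iterated integrals into integrals over the
    full spaces. *)
Lemma fubini_tonelli_on :
  \int[m1]_(x in A) \int[m2]_(y in B) f (x, y) =
  \int[m2]_(y in B) \int[m1]_(x in A) f (x, y).
Proof.
pose g := f \_ (A `*` B).
have gl x : (fun x => \int[m2]_(y in B) f (x, y)) \_ A x =
    \int[m2]_y g (x, y).
  rewrite patchE; case: ifPn => xA.
    rewrite integral_mkcond; apply: eq_integral => z _.
    by rewrite /g !patchE in_setX xA.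
  rewrite integral0_eq// => z _.
  by rewrite /g patchE in_setX (negbTE xA).
have gr y : (fun y => \int[m1]_(x in A) f (x, y)) \_ B y =
    \int[m1]_x g (x, y).
  rewrite patchE; case: ifPn => yB.
    rewrite integral_mkcond; apply: eq_integral => z _.
    by rewrite /g !patchE in_setX yB andbT.
  rewrite integral0_eq// => z _.
  by rewrite /g patchE in_setX (negbTE yB) andbF.
rewrite integral_mkcond [RHS]integral_mkcond.
under eq_integral do rewrite gl.
under [RHS]eq_integral do rewrite gr.
apply: fubini_tonelli => [|z].
  apply/measurable_restrict; [exact: measurableX|by []|].
  exact: measurable_funTS.
by rewrite /g patchE; case: ifP.
Qed.

End fubini_on.

(** * Scaling on the positive half-line *)

Local Notation Rpos R := (`]0%R, +oo[%classic : set R).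

(** Lebesgue measure is [c] times its own image under multiplication by [c]: the two measures agree
    on half-open intervals, hence everywhere. The half-line is its own preimage. *)
Lemma ge0_integral_scale (R : realType) (c : R) (f : R -> \bar R) :
  0 < c -> measurable_fun setT f -> (forall x, (0 <= f x)%E) ->
  (\int[@lebesgue_measure R]_(x in Rpos R) f x =
   c%:E * \int[@lebesgue_measure R]_(x in Rpos R) f (c * x)%R)%E.
Proof.
move=> c0 mf f0.
pose phi (x : measurableTypeR R) : measurableTypeR R := c * x.
have mphi : measurable_fun setT phi by exact: mulrl_measurable.
pose m0 : {measure set (measurableTypeR R) -> \bar R} :=
  mscale (NngNum (ltW c0)) (pushforward (@lebesgue_measure R) phi).
pose m := m0 mphi.
have mE (A : set (measurableTypeR R)) : measurable A -> lebesgue_measure A = m A.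
  apply: lebesgue_measure_unique => _ [[a b] _ <-].
  rewrite [RHS](_ : _ = c%:E * lebesgue_measure (phi @^-1` `]a, b]))%E//.
  have -> : phi @^-1` `]a, b] = `]c^-1 * a, c^-1 * b]%classic.
    apply/seteqP; split => x; rewrite /phi /= !in_itv/=.
      by rewrite !(mulrC c^-1) ltr_pdivrMr// ler_pdivlMr// (mulrC x).
    by rewrite !(mulrC c^-1) ltr_pdivrMr// ler_pdivlMr// (mulrC x).
  rewrite !lebesgue_measure_itv/= !lte_fin ltr_pM2l ?invr_gt0//.
  case: ifP => _; last by rewrite mule0.
  by rewrite -!EFinB -EFinM -mulrBr mulrA divff ?gt_eqF// mul1r.
have mD : measurable (Rpos R) by [].
rewrite (eq_measure_integral m) => [|A mA _]; last exact: mE.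
rewrite ge0_integral_mscale//; last exact: measurable_funTS.
congr (_ * _)%E.
rewrite ge0_integral_pushforward//; last exact: measurable_funTS.
congr (integral _ _ _); apply/seteqP; split => x; rewrite /= /phi !in_itv/= !andbT.
  by rewrite pmulr_rgt0.
by rewrite pmulr_rgt0.
Qed.

(** * The Macdonald function and the change of variables *)

Definition gig_weight (R : realType) (lambda z x : R) : R :=
  x `^ (lambda - 1) * expR (- (z / 2) * (x + x^-1)).

(** This is 2 K_lambda(z) as an extended real: finiteness must be proved, whereas [macdonald] takes
    the value 0 when the integral diverges. *)
Definition gig_mass (R : realType) (lambda z : R) : \bar R :=
  (\int[@lebesgue_measure R]_(x in Rpos R) (gig_weight lambda z x)%:E)%E.

Section macdonald.
Context (R : realType) (lambda : R).
Local Notation leb := (@lebesgue_measure R).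
Local Notation w := (gig_weight lambda).
Local Notation K := (macdonald lambda).

Lemma gig_weight_ge0 z x : 0 <= w z x.
Proof. by rewrite mulr_ge0 ?powR_ge0 ?expR_ge0. Qed.

Lemma gig_weight_gt0 z x : 0 < x -> 0 < w z x.
Proof. by move=> x0; rewrite mulr_gt0 ?powR_gt0 ?expR_gt0. Qed.

Lemma measurable_gig_weight d (T : measurableType d) (z x : T -> R) :
  measurable_fun setT z -> measurable_fun setT x ->
  measurable_fun setT (fun t => w (z t) (x t)).
Proof.
move=> mz mx; apply: measurable_funM.
  exact: (measurableT_comp (measurable_powR _)).
apply: measurableT_comp => //; apply: measurable_funM.
  apply: measurable_funN.
  exact: measurable_funM.
by apply: measurable_funD => //; exact: measurable_funV.
Qed.

Lemma macdonaldE z : K z = 2^-1 * fine (gig_mass lambda z).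
Proof. by []. Qed.

Lemma macdonald_ge0 z : 0 <= K z.
Proof.
rewrite macdonaldE mulr_ge0 ?invr_ge0// fine_ge0// integral_ge0// => x _.
by rewrite lee_fin gig_weight_ge0.
Qed.

Lemma measurable_gig_mass : measurable_fun setT (gig_mass lambda).
Proof.
apply: (@measurable_fun_integral_on _ _ _ _ _ leb _ _
  (fun t : R * R => (w t.1 t.2)%:E)) => //.
- by apply/measurable_EFinP/measurable_gig_weight.
- by move=> t; rewrite lee_fin gig_weight_ge0.
Qed.

Lemma measurable_macdonald : measurable_fun setT K.
Proof.
apply: measurable_funM => //.
by apply: measurableT_comp => //; exact: measurable_gig_mass.
Qed.

(** A zero integral would make the weight vanish almost everywhere, yet it is positive on a
    half-line of infinite measure. *)
Lemma gig_mass_gt0 z : (0 < gig_mass lambda z)%E.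
Proof.
have m0 : (0 <= gig_mass lambda z)%E.
  by apply: integral_ge0 => x _; rewrite lee_fin gig_weight_ge0.
rewrite lt_neqAle m0 andbT; apply/negP => /eqP J0.
have : (\int[leb]_(x in Rpos R) `|(w z x)%:E| = 0)%E.
  rewrite [RHS]J0; apply: eq_integral => x _.
  by rewrite gee0_abs// lee_fin gig_weight_ge0.
move=> /ae_eq_integral_abs[]//.
  by apply/measurable_EFinP/measurable_funTS/measurable_gig_weight.
move=> N [mN N0 DN].
have : (leb (Rpos R) <= leb N)%E.
  apply: le_measure; rewrite ?inE// => x /= x0; apply: DN => /= /(_ x0).
  move: x0; rewrite in_itv/= andbT => x0 [] /eqP.
  by rewrite gt_eqF// gig_weight_gt0.
by rewrite N0 lebesgue_measure_itv/= ltry oppr0 adde0 leNgt ltry.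
Qed.

Lemma le_gig_mass z z' : z <= z' -> (gig_mass lambda z' <= gig_mass lambda z)%E.
Proof.
move=> zz'; apply: ge0_le_integral => //.
- by move=> x _; rewrite lee_fin gig_weight_ge0.
- by apply/measurable_EFinP/measurable_funTS/measurable_gig_weight.
- by apply/measurable_EFinP/measurable_funTS/measurable_gig_weight.
move=> x /=; rewrite in_itv/= andbT lee_fin => x0.
rewrite ler_wpM2l ?powR_ge0// ler_expR ler_wpM2r//.
  by rewrite addr_ge0// ?invr_ge0 ltW.
by rewrite lerN2 ler_pM2r.
Qed.

(** Pointwise form of the change of variables, with g = y/s and u = v/g; the factors 1/s and 1/g are
    the Jacobians of two successive scalings. *)
Lemma gig_weight_change (A x y v : R) : 0 < x -> 0 < y -> 0 < v ->
  let s := x + v^-1 in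
  s^-1 * ((s^-1 * y)^-1 *
    (w A (s^-1 * y) * w (A / x) ((s^-1 * y)^-1 * v))) =
  y^-1 * expR (- (A * (x ^+ 2 + y ^+ 2 + 1) / (2 * x * y))) * w (A / y) v.
Proof.
move=> x0 y0 v0 s.
have s0 : 0 < s by rewrite addr_gt0 ?invr_gt0.
set g := s^-1 * y.
have g0 : 0 < g by rewrite mulr_gt0 ?invr_gt0.
(* The powers of g cancel, because g (v/g) = v. *)
have -> : w A g * w (A / x) (g^-1 * v) =
    v `^ (lambda - 1) * expR (- (A / 2) * (g + g^-1) +
       - (A / x / 2) * (g^-1 * v + (g^-1 * v)^-1)).
  rewrite expRD /gig_weight.
  have -> : v `^ (lambda - 1) = g `^ (lambda - 1) * (g^-1 * v) `^ (lambda - 1).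
    have gv0 : 0 <= g^-1 * v by apply: mulr_ge0; rewrite ?invr_ge0 ltW.
    by rewrite -powRM ?(ltW g0)// mulVKf// gt_eqF.
  by rewrite mulrACA.
(* The Jacobians combine into 1/y, because s g = y. *)
have -> : s^-1 * (g^-1 * (v `^ (lambda - 1) * expR (- (A / 2) * (g + g^-1) +
       - (A / x / 2) * (g^-1 * v + (g^-1 * v)^-1)))) =
   y^-1 * (v `^ (lambda - 1) * expR (- (A / 2) * (g + g^-1) +
       - (A / x / 2) * (g^-1 * v + (g^-1 * v)^-1))).
  by rewrite mulrA -invfM /g mulVKf// gt_eqF.
rewrite -[RHS]mulrA; congr (_ * _); rewrite [RHS]mulrCA; congr (_ * _).
rewrite -[RHS]expRD; congr expR.
(* What remains is an equality of exponents, rational in x, y and v once s is a single fraction. *)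
have sE : s = (x * v + 1) / v by rewrite /s mulrDl mulfK ?gt_eqF// mul1r.
have ? : x * v + 1 != 0 by rewrite gt_eqF// addr_gt0// mulr_gt0.
by rewrite /g sE; field; apply/and4P; split => //; rewrite gt_eqF.
Qed.

(** The map from (g, u) to (y, v) splits into two one-dimensional scalings: v = u g at fixed g, then
    y = g (x + 1/v) at fixed v. Tonelli's theorem exchanges the order of integration between them,
    so no two-dimensional Jacobian occurs. *)
Lemma gig_change_of_variables (A x : R) (F : R * R -> \bar R) : 0 < x ->
  measurable_fun setT F -> (forall t, 0 <= F t)%E ->
  (\int[leb]_(u in Rpos R) \int[leb]_(g in Rpos R)
     (F (g * x + u^-1, u * g)%R * (w A g * w (A / x) u)%:E) =
   \int[leb]_(y in Rpos R) \int[leb]_(v in Rpos R)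
     (F (y, v) *
      (y^-1 * expR (- (A * (x ^+ 2 + y ^+ 2 + 1) / (2 * x * y))) *
        w (A / y) v)%:E))%E.
Proof.
move=> x0 mF F0.
(* Integrands in the variables (g, u), (g, v) and (y, v). The absolute values in the last two keep
   them nonnegative on the whole plane, as Tonelli's theorem asks. *)
pose H1 (t : R * R) : \bar R :=
  (F (t.1 * x + t.2^-1, t.2 * t.1)%R * (w A t.1 * w (A / x) t.2)%:E)%E.
pose H2 (t : R * R) : \bar R :=
  (F (t.1 * (x + t.2^-1), t.2)%R *
    (`|t.1|^-1 * (w A t.1 * w (A / x) (t.1^-1 * t.2)))%:E)%E.
pose H3 (t : R * R) : \bar R :=
  (F t *
    (`|t.1|^-1 * expR (- (A * (x ^+ 2 + t.1 ^+ 2 + 1) / (2 * x * t.1))) *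
        w (A / t.1) t.2)%:E)%E.
have m1 : measurable_fun setT (@fst R R) by exact: measurable_fst.
have m2 : measurable_fun setT (@snd R R) by exact: measurable_snd.
have mV1 : measurable_fun setT (fun t : R * R => t.1^-1).
  exact: measurable_funV.
have mV2 : measurable_fun setT (fun t : R * R => t.2^-1).
  exact: measurable_funV.
have mN1 : measurable_fun setT (fun t : R * R => `|t.1|^-1).
  by apply: measurable_funV; apply: measurableT_comp => //.
have H10 t : (0 <= H1 t)%E.
  by rewrite /H1 mule_ge0// lee_fin mulr_ge0// gig_weight_ge0.
have mH1 : measurable_fun setT H1.
  apply: emeasurable_funM.
    apply: (measurableT_comp mF); apply: measurable_fun_pair.
      by apply: measurable_funD => //; exact: measurable_funM.
    exact: measurable_funM.
  apply/measurable_EFinP; apply: measurable_funM; apply: measurable_gig_weight => //.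
have H20 t : (0 <= H2 t)%E.
  apply: mule_ge0 => //; rewrite lee_fin.
  by repeat apply: mulr_ge0; rewrite ?invr_ge0 ?powR_ge0 ?expR_ge0.
have mH2 : measurable_fun setT H2.
  apply: emeasurable_funM.
    apply: (measurableT_comp mF); apply: measurable_fun_pair => //.
    by apply: measurable_funM => //; exact: measurable_funD.
  apply/measurable_EFinP; apply: measurable_funM => //.
  apply: measurable_funM; apply: measurable_gig_weight => //.
  exact: measurable_funM.
have H30 t : (0 <= H3 t)%E.
  apply: mule_ge0 => //; rewrite lee_fin.
  by repeat apply: mulr_ge0; rewrite ?invr_ge0 ?powR_ge0 ?expR_ge0.
have mH3 : measurable_fun setT H3.
  apply: emeasurable_funM => //; apply/measurable_EFinP.
  apply: measurable_funM; last first.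
    by apply: measurable_gig_weight => //; exact: measurable_funM.
  apply: measurable_funM => //; apply: measurableT_comp => //.
  apply: measurable_funN; apply: measurable_funM.
    apply: measurable_funM => //; apply: measurable_funD => //.
    by apply: measurable_funD => //; exact: measurable_funX.
  by apply: measurable_funV; exact: measurable_funM.
have mD : measurable (Rpos R) by [].
have mF1 (c : R) (H : R * R -> \bar R) (g : R) : measurable_fun setT H ->
    measurable_fun setT (fun v => H (g, c * v)%R).
  move=> mH; apply: (measurableT_comp mH); apply: measurable_fun_pair => //.
have mF2 (c : R) (H : R * R -> \bar R) (v : R) : measurable_fun setT H ->
    measurable_fun setT (fun g => H (c * g, v)%R).
  move=> mH; apply: (measurableT_comp mH); apply: measurable_fun_pair => //.
transitivity (\int[leb]_(g in Rpos R) \int[leb]_(u in Rpos R) H1 (g, u))%E.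
  exact/esym/(fubini_tonelli_on leb leb mD mD mH1 H10).
(* At fixed g, substitute u = v/g; then g x + 1/u = g (x + 1/v). *)
transitivity (\int[leb]_(g in Rpos R) \int[leb]_(v in Rpos R) H2 (g, v))%E.
  apply: eq_integral => g; rewrite inE/= in_itv/= andbT => g0.
  rewrite (@ge0_integral_scale _ g^-1) ?invr_gt0//; last first.
    by apply: (@measurable_comp _ _ _ _ _ _ setT _ _ _ _ _ mH1) => //;
      apply: measurable_fun_pair.
  rewrite -ge0_integralZl//; last 2 first.
  - by apply: measurable_funTS; apply: (mF1 g^-1 H1 g mH1).
  - rewrite lee_fin invr_ge0; exact: ltW.
  apply: eq_integral => v; rewrite inE/= in_itv/= andbT => v0.
  rewrite /H1 /H2/= muleCA -EFinM gtr0_norm//; congr (F (_, _) * _)%E.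
  - by rewrite mulrDr invfM invrK.
  - by rewrite mulrAC mulVf ?mul1r// gt_eqF.
transitivity (\int[leb]_(v in Rpos R) \int[leb]_(g in Rpos R) H2 (g, v))%E.
  exact: (fubini_tonelli_on leb leb mD mD mH2 H20).
(* At fixed v, substitute g = y / (x + 1/v). *)
transitivity (\int[leb]_(v in Rpos R) \int[leb]_(y in Rpos R) H3 (y, v))%E.
  apply: eq_integral => v; rewrite inE/= in_itv/= andbT => v0.
  have s0 : 0 < x + v^-1 by rewrite addr_gt0 ?invr_gt0.
  rewrite (@ge0_integral_scale _ (x + v^-1)^-1) ?invr_gt0//; last first.
    by apply: (@measurable_comp _ _ _ _ _ _ setT _ _ _ _ _ mH2) => //;
      apply: measurable_fun_pair.
  rewrite -ge0_integralZl//; last 2 first.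
  - by apply: measurable_funTS; apply: (mF2 _ H2 v mH2).
  - rewrite lee_fin invr_ge0; exact: ltW.
  apply: eq_integral => y; rewrite inE/= in_itv/= andbT => y0.
  rewrite /H2 /H3/= muleCA -EFinM !gtr0_norm ?mulr_gt0 ?invr_gt0//.
  rewrite gig_weight_change//; congr (F (_, _) * _)%E.
  by rewrite mulrAC mulVf ?mul1r// gt_eqF.
transitivity (\int[leb]_(y in Rpos R) \int[leb]_(v in Rpos R) H3 (y, v))%E.
  exact/esym/(fubini_tonelli_on leb leb mD mD mH3 H30).
apply: eq_integral => y; rewrite inE/= in_itv/= andbT => y0.
by apply: eq_integral => v _; rewrite /H3/= gtr0_norm.
Qed.

(** If the mass were infinite at z, monotonicity would make it infinite at A/y for all y > A/z. But
    the change of variables with x = 1 and F = 1 expresses the square of the finite mass at A as an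
    integral over y of the mass at A/y with a positive factor. *)
Lemma gig_mass_lty (A z : R) : (gig_mass lambda A < +oo)%E -> 0 < A -> 0 < z ->
  (gig_mass lambda z < +oo)%E.
Proof.
move=> JA A0 z0; rewrite ltNge; apply/negP; rewrite leye_eq => /eqP Jz.
have Jy z' : z' <= z -> gig_mass lambda z' = +oo%E.
  by move=> z'z; apply/eqP; rewrite -leye_eq -Jz le_gig_mass.
have JAfin : gig_mass lambda A \is a fin_num by rewrite gt0_fin_numE ?gig_mass_gt0.
pose c y := y^-1 * expR (- (A * (1 ^+ 2 + y ^+ 2 + 1) / (2 * 1 * y))).
have c0 y : 0 < y -> 0 < c y by move=> y0; rewrite mulr_gt0 ?expR_gt0 ?invr_gt0.
have wm z' : measurable_fun (Rpos R) (EFin \o w z').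
  by apply/measurable_EFinP/measurable_funTS/measurable_gig_weight.
have := @gig_change_of_variables A 1 (cst 1%E) ltr01 (measurable_cst _) (fun=> lee01).
(* For F = 1 and x = 1 the integrand on the left is a product of a function of u and a function of
   g. *)
have -> : (\int[leb]_(u in Rpos R) \int[leb]_(g in Rpos R)
    (cst 1 (g * 1 + u^-1, u * g)%R * (w A g * w (A / 1) u)%:E) =
    gig_mass lambda A * gig_mass lambda A)%E.
  transitivity (\int[leb]_(u in Rpos R) ((w A u)%:E * gig_mass lambda A))%E.
    apply: eq_integral => u _.
    under eq_integral do rewrite /= mul1e divr1 mulrC EFinM.
    rewrite ge0_integralZl//; first exact: wm.
      by move=> x _; rewrite lee_fin gig_weight_ge0.
    by rewrite lee_fin gig_weight_ge0.
  rewrite ge0_integralZr//; first exact: wm.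
    by move=> x _; rewrite lee_fin gig_weight_ge0.
  by rewrite ltW ?gig_mass_gt0.
under eq_integral => y.
  rewrite inE/= in_itv/= andbT => y0.
  under eq_integral do rewrite /= mul1e -/(c y) EFinM.
  rewrite ge0_integralZl//; last 3 first.
  - exact: wm.
  - by move=> x _; rewrite lee_fin gig_weight_ge0.
  - by rewrite lee_fin (ltW (c0 _ y0)).
  over.
move=> JE.
have : leb.-integrable (Rpos R) (fun y => (c y)%:E * gig_mass lambda (A / y))%E.
  apply/integrableP; split.
    apply: measurable_funTS; apply: emeasurable_funM.
      apply/measurable_EFinP; apply: measurable_funM.
        exact: measurable_invr.
      apply: measurableT_comp => //; apply: measurable_funN.
      apply: measurable_funM; last first.
        by apply: measurable_funV; exact: measurable_funM.
      apply: measurable_funM => //; apply: measurable_funD => //.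
      by apply: measurable_funD => //; exact: measurable_funX.
    apply: (measurableT_comp measurable_gig_mass).
    by apply: measurable_funM => //; exact: measurable_invr.
  suff -> : (\int[leb]_(y in Rpos R) `|(c y)%:E * gig_mass lambda (A / y)| =
      gig_mass lambda A * gig_mass lambda A)%E.
    by rewrite -(fineK JAfin) -EFinM ltry.
  rewrite JE; apply: eq_integral => y; rewrite inE/= in_itv/= andbT => y0.
  by rewrite gee0_abs// mule_ge0 ?lee_fin ?(ltW (c0 _ y0)) ?(ltW (gig_mass_gt0 _)).
move=> /integrable_ae[]// N [mN N0 DN].
(* On this half-line the integrand is infinite, so an infinite length would fit into the null set
   [N]. *)
have : (leb `](A / z)%R, +oo[ <= leb N)%E.
  apply: le_measure; rewrite ?inE// => y /=; rewrite in_itv/= andbT => zy.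
  have y0 : 0 < y by rewrite (lt_trans _ zy)// divr_gt0.
  apply: DN => /=; rewrite in_itv/= y0 => /(_ isT).
  rewrite Jy; last by rewrite ler_pdivrMr// mulrC -ler_pdivrMr// ltW.
  by rewrite gt0_muley// lte_fin c0.
by rewrite N0 lebesgue_measure_itv/= ltry addye// leNgt ltry.
Qed.

Lemma macdonald_gt0 z : (gig_mass lambda z < +oo)%E -> 0 < K z.
Proof.
by move=> Joo; rewrite macdonaldE mulr_gt0 ?invr_gt0// fine_gt0// gig_mass_gt0.
Qed.

Lemma gig_mass_macdonald z : (gig_mass lambda z < +oo)%E ->
  gig_mass lambda z = (2 * K z)%:E.
Proof.
move=> Joo; rewrite macdonaldE mulrA divff// mul1r fineK//.
by rewrite gt0_fin_numE// gig_mass_gt0.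
Qed.

End macdonald.


(** * The conditional density and the transition density *)

Section kernel.
Context (R : realType) (lambda a : R).
Local Notation leb := (@lebesgue_measure R).
Local Notation w := (gig_weight lambda).
Local Notation K := (macdonald lambda).

(* The conditional density of the product of the gammas given Z_n = y; it is
   cut off outside of the state space so as to have mass at most 1 everywhere. *)
Definition cond_density (y v : R) : R :=
  \1_(Rpos R) y * ((2 * K (a ^+ 2 / y))^-1 * w (a ^+ 2 / y) v).

(** For y > 0, the candidate for the conditional expectation of F(Z_n, W_n) given Z_n = y. *)
Definition cond_expect (F : R * R -> \bar R) (y : R) : \bar R :=
  (\int[leb]_(v in Rpos R) (F (y, v) * (cond_density y v)%:E))%E.

Lemma cond_density_ge0 y v : 0 <= cond_density y v.
Proof.
apply: mulr_ge0; first by rewrite indicE ler0n.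
apply: mulr_ge0; last exact: gig_weight_ge0.
by rewrite invr_ge0 mulr_ge0 ?macdonald_ge0.
Qed.

Lemma cond_densityE y v : 0 < y ->
  cond_density y v = (2 * K (a ^+ 2 / y))^-1 * w (a ^+ 2 / y) v.
Proof.
by move=> y0; rewrite /cond_density indicE mem_set ?mul1r//= in_itv/= y0.
Qed.

Lemma measurable_cond_density :
  measurable_fun setT (fun t : R * R => cond_density t.1 t.2).
Proof.
have m1 : measurable_fun setT (@fst R R) by exact: measurable_fst.
have mV : measurable_fun setT (fun t : R * R => a ^+ 2 / t.1).
  by apply: measurable_funM => //; exact: measurable_funV.
apply: measurable_funM.
  by apply: measurableT_comp => //; exact: measurable_indic.
apply: measurable_funM; last exact: measurable_gig_weight.
apply: measurable_funV; apply: measurable_funM => //.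
exact: (measurableT_comp (@measurable_macdonald R lambda)).
Qed.

Lemma measurable_cond_density2 y : measurable_fun setT (cond_density y).
Proof. exact: (measurable_fun_pair2 y measurable_cond_density). Qed.

Lemma gig_density_ge0 x : 0 <= gig_density lambda a x.
Proof.
by rewrite mulr_ge0 ?gig_weight_ge0// invr_ge0 mulr_ge0 ?macdonald_ge0.
Qed.

Lemma measurable_gig_density : measurable_fun setT (gig_density lambda a).
Proof. by apply: measurable_funM => //; exact: measurable_gig_weight. Qed.

(** Base case of the induction: Z_1 = 1 and W_1 = gamma_0. *)
Lemma gig_density_cond : gig_density lambda a =1 cond_density 1.
Proof. by move=> x; rewrite cond_densityE// divr1. Qed.

Lemma Qdensity_ge0 x y : 0 < y -> 0 <= Qdensity lambda a x y.
Proof.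
move=> y0; apply: mulr_ge0; last exact: expR_ge0.
apply: mulr_ge0; last by rewrite invr_ge0 ltW.
by apply: mulr_ge0; rewrite ?invr_ge0 mulr_ge0 ?invr_ge0 ?macdonald_ge0.
Qed.

Lemma measurable_Qdensity :
  measurable_fun setT (fun t : R * R => Qdensity lambda a t.1 t.2).
Proof.
have m1 : measurable_fun setT (@fst R R) by exact: measurable_fst.
have m2 : measurable_fun setT (@snd R R) by exact: measurable_snd.
have mK (f : R * R -> R) : measurable_fun setT f ->
    measurable_fun setT (fun t => K (a ^+ 2 / f t)).
  move=> mf; apply: (measurableT_comp (@measurable_macdonald R lambda)).
  by apply: measurable_funM => //; exact: measurable_funV.
apply: measurable_funM.
  apply: measurable_funM; last exact: measurable_funV.
  apply: measurable_funM => //; apply: measurable_funM; first exact: mK.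
  by apply: measurable_funV; apply: mK.
apply: measurableT_comp => //; apply: measurable_funN; apply: measurable_funM.
  apply: measurable_funM => //; apply: measurable_funD => //.
  by apply: measurable_funD; exact: measurable_funX.
by apply: measurable_funV; apply: measurable_funM => //; exact: measurable_funM.
Qed.

Section finite_mass.
Hypotheses (a_gt0 : 0 < a) (mass_lty : (gig_mass lambda (a ^+ 2) < +oo)%E).

Let mass_div_lty y : 0 < y -> (gig_mass lambda (a ^+ 2 / y) < +oo)%E.
Proof.
by move=> y0; apply: (gig_mass_lty mass_lty); rewrite ?divr_gt0 ?exprn_gt0.
Qed.

Lemma integral_cond_density y : 0 < y ->
  (\int[leb]_(v in Rpos R) (cond_density y v)%:E = 1)%E.
Proof.
move=> y0; under eq_integral do rewrite cond_densityE// EFinM.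
rewrite ge0_integralZl//; last 3 first.
- by apply/measurable_EFinP/measurable_funTS/measurable_gig_weight.
- by move=> v _; rewrite lee_fin gig_weight_ge0.
- by rewrite lee_fin invr_ge0 mulr_ge0 ?macdonald_ge0.
rewrite -/(gig_mass _ _) gig_mass_macdonald ?mass_div_lty// -EFinM mulVf//.
by rewrite gt_eqF// mulr_gt0 ?macdonald_gt0 ?mass_div_lty.
Qed.

Lemma measurable_cond_expect_integrand F y : measurable_fun setT F ->
  measurable_fun setT (fun v => F (y, v) * (cond_density y v)%:E)%E.
Proof.
move=> mF; apply: emeasurable_funM.
  exact: measurable_fun_pair2.
by apply/measurable_EFinP; exact: measurable_cond_density2.
Qed.

Lemma cond_expect_ge0 F y : (forall t, 0 <= F t)%E -> (0 <= cond_expect F y)%E.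
Proof.
by move=> F0; apply: integral_ge0 => v _; rewrite mule_ge0// lee_fin cond_density_ge0.
Qed.

Lemma measurable_cond_expect F :
  measurable_fun setT F -> (forall t, 0 <= F t)%E ->
  measurable_fun setT (cond_expect F).
Proof.
move=> mF F0; apply: (@measurable_fun_integral_on _ _ _ _ _ leb _ _
  (fun t : R * R => F t * (cond_density t.1 t.2)%:E)%E) => //.
- apply: emeasurable_funM => //; apply/measurable_EFinP.
  exact: measurable_cond_density.
- by move=> t; rewrite mule_ge0// lee_fin cond_density_ge0.
Qed.

(** The factor [f y] leaves the integral and the density has total mass 1. *)
Lemma cond_expect_fst (f : R -> \bar R) y : 0 < y -> (0 <= f y)%E ->
  cond_expect (fun t => f t.1) y = f y.
Proof.
move=> y0 fy; rewrite /cond_expect/= ge0_integralZl//; last 2 first.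
- by apply/measurable_EFinP/measurable_funTS; exact: measurable_cond_density2.
- by move=> v _; rewrite lee_fin cond_density_ge0.
by rewrite integral_cond_density// mule1.
Qed.

Lemma cond_expect_le1 F y : measurable_fun setT F -> (forall t, 0 <= F t)%E ->
  (forall t, F t <= 1)%E -> (cond_expect F y <= 1)%E.
Proof.
move=> mF F0 F1; have [y0|y0] := ltP 0 y.
  rewrite -(integral_cond_density y0); apply: ge0_le_integral => //.
  - by move=> v _; rewrite mule_ge0// lee_fin cond_density_ge0.
  - by apply: measurable_funTS; exact: measurable_cond_expect_integrand.
  - by apply/measurable_EFinP/measurable_funTS; exact: measurable_cond_density2.
  - by move=> v _; rewrite -[leRHS]mul1e lee_wpmul2r// lee_fin cond_density_ge0.
rewrite /cond_expect integral0_eq// => v _.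
rewrite /cond_density indicE memNset ?mul0r ?mule0//=.
by rewrite in_itv/= andbT; apply/negP; rewrite -leNgt.
Qed.

(** Normalized form of [gig_change_of_variables]: if Z_n = x and W_n has its conditional law, one
    step moves Z to y with density Q(x, y) and leaves W with the conditional law attached to y. *)
Lemma transition_change_of_variables x (F : R * R -> \bar R) : 0 < x ->
  measurable_fun setT F -> (forall t, 0 <= F t)%E ->
  cond_expect (fun t => \int[leb]_(g in Rpos R)
     (F (g * t.1 + t.2^-1, t.2 * g)%R * (gig_density lambda a g)%:E))%E x =
  (\int[leb]_(y in Rpos R) ((Qdensity lambda a x y)%:E * cond_expect F y))%E.
Proof.
move=> x0 mF F0; set A := a ^+ 2.
(* The normalizing constants of the densities of gamma_n and of W_n given Z_n = x, absorbed into
   F. *)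
pose C := (2 * K A)^-1 * (2 * K (A / x))^-1.
have C0 : 0 <= C by apply: mulr_ge0; rewrite invr_ge0 mulr_ge0 ?macdonald_ge0.
pose G t := (C%:E * F t)%E.
have mG : measurable_fun setT G by exact: measurable_funeM.
have G0 t : (0 <= G t)%E by rewrite mule_ge0.
transitivity (\int[leb]_(u in Rpos R) \int[leb]_(g in Rpos R)
     (G (g * x + u^-1, u * g)%R * (w A g * w (A / x) u)%:E))%E.
  apply: eq_integral => u _; rewrite -ge0_integralZr//; last 3 first.
  - apply: measurable_funTS; apply: emeasurable_funM.
      apply: (measurableT_comp mF); apply: measurable_fun_pair => //.
      by apply: measurable_funD => //; exact: mulrr_measurable.
    by apply/measurable_EFinP; exact: measurable_gig_density.
  - by move=> g _; rewrite mule_ge0// lee_fin gig_density_ge0.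
  - by rewrite lee_fin cond_density_ge0.
  apply: eq_integral => g _; rewrite /G -muleA muleAC [RHS]muleC; congr (_ * _)%E.
  rewrite -!EFinM; congr EFin; rewrite cond_densityE// /gig_density /C -/A.
  by rewrite mulrACA.
rewrite gig_change_of_variables//.
apply: eq_integral => y; rewrite inE/= in_itv/= andbT => y0.
rewrite /cond_expect -ge0_integralZl//; last 3 first.
- by apply: measurable_funTS; exact: measurable_cond_expect_integrand.
- by move=> v _; rewrite mule_ge0// lee_fin cond_density_ge0.
- by rewrite lee_fin Qdensity_ge0.
apply: eq_integral => v _.
rewrite [RHS]muleCA /G muleAC [LHS]muleC; congr (_ * _)%E.
rewrite -!EFinM; congr EFin.
rewrite cond_densityE// /Qdensity /C -/A.
(* K(A/y) in the numerator of Q cancels against the normalization of the conditional density at y;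
   this requires nonzero values of K. *)
have /gt_eqF Ky := macdonald_gt0 (mass_div_lty y0).
have /gt_eqF Kx := macdonald_gt0 (mass_div_lty x0).
have /gt_eqF KA := macdonald_gt0 mass_lty.
move: Ky Kx KA (gt_eqF y0); rewrite -/A.
move: (expR _) (w _ v) (K A) (K (A / y)) (K (A / x)) => e q KA Ky Kx Ky0 Kx0 KA0 y_neq0.
by field; rewrite Kx0 KA0 Ky0 y_neq0.
Qed.

End finite_mass.
End kernel.

(** * Integration over a variable independent of a sigma-algebra *)

Section independence.
Local Open Scope ereal_scope.
Context d d' (T : measurableType d) (T' : measurableType d') (R : realType).
Context (P : probability T R) (X : {RV P >-> T'}) (C : set (set T)).
Hypotheses (mC : C `<=` measurable) (CI : setI_closed C) (CT : C setT).
Hypothesis indepC : forall A B, C A -> measurable B ->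
  P (A `&` X @^-1` B) = P A * P (X @^-1` B).

Let mX B : measurable B -> measurable (X @^-1` B).
Proof. by move=> mB; rewrite -[_ @^-1` _]setTI; exact: measurable_funP. Qed.

Lemma g_sigma_algebra_measurable A : <<s C >> A -> measurable A.
Proof. exact: (smallest_sub (@sigma_algebra_measurable _ T) mC). Qed.

(** Both sides are finite measures in [A] that agree on the pi-system [C], hence on the
    sigma-algebra it generates. *)
Lemma indep_g_sigma_algebra A B : <<s C >> A -> measurable B ->
  P (A `&` X @^-1` B) = P A * P (X @^-1` B).
Proof.
move=> CA mB.
have pB : (0 <= fine (P (X @^-1` B)))%R by rewrite fine_ge0.
have pBE : (fine (P (X @^-1` B)))%:E = P (X @^-1` B).
  by rewrite fineK// fin_num_measure//; exact: mX.
pose m1 : {measure set T -> \bar R} := mrestr P (mX mB).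
pose m2 : {measure set T -> \bar R} := mscale (NngNum pB) P.
suff : m1 A = m2 A by rewrite /m1 /m2 /= /mrestr /mscale/= pBE muleC.
apply: (g_sigma_algebra_measure_unique C mC (fun=> setT)) => //.
- by rewrite bigcup_const.
- move=> E CE; rewrite /m1 /m2 /= /mrestr /mscale/= pBE muleC.
  exact: indepC.
- move=> _; rewrite /m1/= /mrestr; apply: (le_lt_trans (probability_le1 _ _)).
    by apply: measurableI => //; exact: mX.
  exact: ltry.
Qed.

(** [F] may depend on the whole past through its first argument: by independence the joint law of
    the identity and [X] is a product, and Tonelli's theorem applies. *)
Lemma indep_integral (F : g_sigma_algebraType C * T' -> \bar R) :
  measurable_fun setT F -> (forall z, 0 <= F z) ->
  \int[P]_t F (t, X t) = \int[P]_t \int[distribution P X]_x F (t, x).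
Proof.
move=> mF F0.
(* The identity of [T], viewed as a random variable valued in [T] with the smaller sigma-algebra. *)
pose idC (t : T) : g_sigma_algebraType C := t.
have midC : measurable_fun setT idC.
  by move=> _ A CA; rewrite setTI; exact: g_sigma_algebra_measurable.
pose YC : {RV P >-> g_sigma_algebraType C} :=
  HB.pack idC (isMeasurableFun.Build _ _ _ _ _ midC).
pose pairC (t : T) : g_sigma_algebraType C * T' := (idC t, X t).
have mpairC : measurable_fun setT pairC by exact: measurable_fun_pair.
pose XC : {RV P >-> (g_sigma_algebraType C * T')%type} :=
  HB.pack pairC (isMeasurableFun.Build _ _ _ _ _ mpairC).
transitivity (\int[distribution P XC]_z F z).
  by rewrite ge0_integral_distribution.
transitivity (\int[distribution P YC \x distribution P X]_z F z).
  apply: eq_measure_integral => A mA _; apply/esym/product_measure_unique => //.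
  move=> B1 B2 mB1 mB2; rewrite /distribution/= /pushforward/=.
  exact: (indep_g_sigma_algebra mB1 mB2).
rewrite fubini_tonelli1// ge0_integral_distribution//.
- exact: (measurable_fun_fubini_tonelli_F F mF F0).
- by move=> t; apply: integral_ge0.
Qed.

End independence.

(** * Recurrence and measurability for the process *)

Lemma Zproc_recr (T : Type) (R : realType) (g : nat -> T -> R) n w :
  Zproc g n.+1 w = g n w * Zproc g n w + (\prod_(0 <= i < n) g i w)^-1.
Proof.
(* The new term k = n has an empty second product and equals 1/W_n; every other term gains the
   factor gamma_n. *)
rewrite /Zproc big_nat_recr//=; congr (_ + _).
  rewrite mulr_sumr; apply: eq_big_nat => k /andP[_ kn].
  by rewrite big_nat_recr//= mulrA mulrC.
by rewrite [X in _ * X]big_geq// mulr1 prodfV.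
Qed.

Section measurable_Zproc.
Context d (T : measurableType d) (R : realType) (g : nat -> T -> R).

Lemma measurable_prefix_prod n :
  (forall i, (i < n)%N -> measurable_fun setT (g i)) ->
  measurable_fun setT (fun w => \prod_(0 <= i < n) g i w).
Proof.
elim: n => [_|n IH mg].
  rewrite (_ : (fun _ => _) = cst 1); first exact: measurable_cst.
  by apply/funext => w; rewrite big_geq.
rewrite (_ : (fun _ => _) = fun w => (\prod_(0 <= i < n) g i w) * g n w); last first.
  by apply/funext => w; rewrite big_nat_recr.
apply: measurable_funM; last exact: mg.
by apply: IH => i ni; apply: mg; exact: ltnW.
Qed.

Lemma measurable_Zproc n :
  (forall i, (i < n)%N -> measurable_fun setT (g i)) ->
  measurable_fun setT (Zproc g n).
Proof.
elim: n => [_|n IH mg].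
  rewrite (_ : Zproc g 0 = cst 0); first exact: measurable_cst.
  by apply/funext => w; rewrite /Zproc big_geq.
rewrite (_ : Zproc g n.+1 = fun w =>
    g n w * Zproc g n w + (\prod_(0 <= i < n) g i w)^-1); last first.
  by apply/funext => w; exact: Zproc_recr.
have mg' i : (i < n)%N -> measurable_fun setT (g i).
  by move=> ni; apply: mg; exact: ltnW.
apply: measurable_funD.
  by apply: measurable_funM; [exact: mg|exact: IH].
by apply: measurable_funV; exact: measurable_prefix_prod.
Qed.

End measurable_Zproc.

Lemma integral_setI_full d (T : measurableType d) (R : realType)
    (P : probability T R) (E X : set T) (f : T -> \bar R) :
  measurable E -> measurable X -> P X = 1%E ->
  measurable_fun setT f -> (forall x, (0 <= f x)%E) ->
  (\int[P]_(x in E) f x = \int[P]_(x in E `&` X) f x)%E.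
Proof.
move=> mE mX PX mf f0.
have PX0 : (P (~` X) = 0)%E by rewrite probability_setC// PX subee.
have mfE : measurable_fun E f by exact: measurable_funTS.
rewrite (ge0_negligible_integral (measurableC mX) mE mfE (fun x _ => f0 x) PX0).
by rewrite setDE setCK.
Qed.

(** * Cylinder events and the past of the process *)

Section cylinders.
Context d (T : measurableType d) (R : realType) (P : probability T R).
Context (gamma : nat -> {RV P >-> R}).

(** A pi-system generating the sigma-algebra of gamma_0, ..., gamma_(n-1), indexed by a list so as
    to match [mutually_independent]. *)
Definition cylinder (n : nat) : set (set T) :=
  [set E | exists2 A : nat -> set R, (forall i, measurable (A i)) &
    E = \bigcap_(i in [set` iota 0 n]) (gamma i @^-1` A i)].

Let mgamma i B : measurable B -> measurable (gamma i @^-1` B).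
Proof. by move=> mB; rewrite -[_ @^-1` _]setTI; exact: measurable_funP. Qed.

Lemma cylinder_measurable n : cylinder n `<=` measurable.
Proof.
by move=> _ [A mA ->]; apply: bigcap_measurableType => i _; exact: mgamma.
Qed.

Lemma cylinder_setI n : setI_closed (cylinder n).
Proof.
move=> _ _ [A mA ->] [B mB ->]; exists (fun i => A i `&` B i).
  by move=> i; exact: measurableI.
apply/seteqP; split => [t [tA tB] i ni|t tAB].
  by split; [exact: tA|exact: tB].
by split => i /tAB[].
Qed.

Lemma cylinder_setT n : cylinder n setT.
Proof. by exists (fun=> setT) => //; apply/seteqP; split. Qed.

Lemma cylinder_preimage n i B : (i < n)%N -> measurable B ->
  cylinder n (gamma i @^-1` B).
Proof.
move=> ni mB; exists (fun j => if j == i then B else setT).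
  by move=> j; case: ifP.
apply/seteqP; split => [t Bt j _ /=|t /(_ i)].
  by case: eqP => // ->.
by rewrite eqxx; apply; rewrite /= mem_iota.
Qed.

Lemma measurable_gamma_cylinder n i : (i < n)%N ->
  measurable_fun setT (gamma i : g_sigma_algebraType (cylinder n) -> R).
Proof.
move=> ni _ B mB; rewrite setTI; apply: sub_sigma_algebra.
exact: cylinder_preimage.
Qed.

(** For i at most n, Z_i is a measurable function of gamma_0, ..., gamma_(n-1); measurability is
    checked with [T] carrying the cylinder sigma-algebra. *)
Lemma past_cylinder n :
  past (Zproc (fun i => gamma i : T -> R)) n `<=` <<s cylinder n >>.
Proof.
apply: smallest_sub; first exact: smallest_sigma_algebra.
move=> _ [i /= /andP[_ ni]] [B mB <-].
apply: (@measurable_Zproc _ (g_sigma_algebraType (cylinder n))) => //.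
by move=> j ji; apply: measurable_gamma_cylinder; exact: leq_trans ni.
Qed.

Hypothesis gamma_indep : mutually_independent P (fun n => gamma n : T -> R).

Lemma cylinder_indep n A B : cylinder n A -> measurable B ->
  (P (A `&` gamma n @^-1` B) = P A * P (gamma n @^-1` B))%E.
Proof.
move=> [F mF ->] mB.
(* The product rule is used twice: for [G] on n+1 indices and for [F] on the first n. *)
pose G i := if i == n then B else F i.
have mG i : measurable (G i) by rewrite /G; case: ifP.
have := gamma_indep (iota_uniq 0 n.+1) mG.
rewrite -addn1 iotaD big_cat big_seq1/= add0n.
have -> : G n = B by rewrite /G eqxx.
have GF i : i \in iota 0 n -> G i = F i.
  by rewrite mem_iota /G => /andP[_ ni]; rewrite lt_eqF.
rewrite (eq_big_seq (fun i => P (gamma i @^-1` F i))); last first.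
  by move=> i /GF ->.
rewrite -(gamma_indep (iota_uniq 0 n) mF) => <-; congr (P _).
apply/seteqP; split => [t [tF tB] i /=|t tG].
  rewrite mem_cat inE => /orP[ni|/eqP ->]; last by rewrite /G eqxx.
  by rewrite GF//; exact: tF.
split => [i /= ni|].
  by rewrite -GF//; apply: tG; rewrite /= mem_cat ni.
by have := tG n; rewrite /G eqxx; apply; rewrite /= mem_cat inE eqxx orbT.
Qed.

End cylinders.

(** * Positivity of the process and the law of the factors *)

Section chain.
Context (R : realType) (d : measure_display) (T : measurableType d).
Context (P : probability T R) (a lambda : R) (gamma : nat -> {RV P >-> R}).
Hypothesis a_gt0 : 0 < a.
Hypothesis gamma_indep : mutually_independent P (fun n => gamma n : T -> R).
Hypothesis gamma_law : forall (n : nat) (A : set R), measurable A ->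
  distribution P (gamma n) A = gig lambda a A.

Local Notation leb := (@lebesgue_measure R).
Local Notation Z := (Zproc (fun n => gamma n : T -> R)).
Local Notation W := (fun n w => \prod_(0 <= i < n) gamma i w).

Let mZ n : measurable_fun setT (Z n).
Proof. by apply: measurable_Zproc. Qed.

Let mW n : measurable_fun setT (W n).
Proof. by apply: measurable_prefix_prod => i _. Qed.

Let mDpos : measurable (Rpos R).
Proof. by []. Qed.

Lemma Zproc1 w : Z 1%N w = 1.
Proof. by rewrite /Zproc big_nat1 !big_geq// mulr1. Qed.

Lemma Zproc_gt0 n w : (0 < n)%N -> (forall i, (i < n)%N -> 0 < gamma i w) ->
  0 < Z n w.
Proof.
move=> n0 g0.
have W0 k : (k <= n)%N -> 0 < W k w.
  move=> kn; rewrite big_nat prodr_gt0// => i /andP[_ ik].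
  by apply: g0; exact: leq_trans kn.
elim: n n0 g0 W0 => // -[|n] IH _ g0 W0; first by rewrite Zproc1.
rewrite Zproc_recr addr_gt0 ?invr_gt0 ?W0// mulr_gt0 ?g0// IH//.
  by move=> i ni; apply: g0; exact: ltnW.
by move=> k kn; apply: W0; exact: ltnW.
Qed.

(** The normalization follows from [gamma_law] on the whole line, since the law of [gamma 0] is a
    probability. *)
Lemma gig_total : gig lambda a (Rpos R) = 1%E.
Proof.
rewrite /gig setIid -[X in (\int[_]_(_ in X) _)%E]setTI.
by rewrite -[LHS](gamma_law 0 measurableT) probability_setT.
Qed.

Lemma Zproc_gt0_as n : (0 < n)%N -> P (Z n @^-1` Rpos R) = 1%E.
Proof.
move=> n0; apply/eqP; rewrite eq_le probability_le1 ?andTb; last first.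
  by rewrite -[X in measurable X]setTI; exact: mZ.
pose pos := \bigcap_(i in [set` iota 0 n]) (gamma i @^-1` Rpos R).
have mpos : measurable pos.
  by apply: (@cylinder_measurable _ _ _ P gamma n); exists (fun=> Rpos R).
(* By the product rule, the first n factors are simultaneously positive with probability 1. *)
have <- : P pos = 1%E.
  rewrite [LHS](gamma_indep (iota_uniq 0 n) (fun=> mDpos)) big1// => i _.
  exact: etrans (gamma_law i mDpos) gig_total.
apply: le_measure; rewrite ?inE//.
  by rewrite -[X in measurable X]setTI; exact: mZ.
move=> t tpos /=; rewrite in_itv/= andbT; apply: Zproc_gt0 => // i ni.
by have := tpos i; rewrite /= mem_iota in_itv/= andbT; exact.
Qed.

(* An infinite mass would make the junk values fine +oo = 0 and 0^-1 = 0 turn the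
   density into 0, contradicting the total mass 1 of the law of the gammas. *)
Lemma gig_mass_sqr_lty : (gig_mass lambda (a ^+ 2) < +oo)%E.
Proof.
rewrite ltNge; apply/negP; rewrite leye_eq => /eqP Joo.
have := gig_total; rewrite /gig integral0_eq => [/eqP|x _].
  by rewrite eq_sym onee_eq0.
by rewrite /gig_density macdonaldE Joo/= !mulr0 invr0 mul0r.
Qed.

Local Notation gd := (gig_density lambda a).

Lemma integral_gamma n (f : R -> \bar R) :
  measurable_fun setT f -> (forall x, (0 <= f x)%E) ->
  (\int[distribution P (gamma n)]_x f x =
   \int[leb]_(x in Rpos R) (f x * (gd x)%:E))%E.
Proof.
move=> mf f0; pose h (x : measurableTypeR R) : R := gd x * \1_(Rpos R) x.
have h0 x : 0 <= h x by rewrite mulr_ge0 ?gig_density_ge0// indicE ler0n.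
have mh : measurable_fun setT h.
  by apply: measurable_funM; [exact: measurable_gig_density|exact: measurable_indic].
have hE (x : R) : (h x)%:E = ((EFin \o gd) \_ (Rpos R)) x.
  by rewrite patchE /h indicE; case: ifP; rewrite ?mulr1 ?mulr0.
(* R and measurableTypeR R carry the same measurable sets but distinct displays;
   the Lebesgue measure lives on the latter. *)
pose g (t : T) : measurableTypeR R := gamma n t.
have mg : measurable_fun setT g.
  move=> _ B mB. exact: (@measurable_funP _ _ _ _ setT (gamma n) measurableT B mB).
pose g' : {RV P >-> measurableTypeR R} :=
  HB.pack g (isMeasurableFun.Build _ _ _ _ _ mg).
transitivity (\int[distribution P g']_x f x)%E.
  by rewrite !ge0_integral_distribution.
rewrite (@integral_density _ _ _ leb _ h mh h0)//.
  rewrite [RHS]integral_mkcond; apply: eq_integral => x _.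
  rewrite hE !patchE; by case: ifP => // _; rewrite mule0.
move=> A mA; rewrite [LHS](gamma_law n mA) /gig integral_mkcondr.
by apply: eq_integral => x _; rewrite hE.
Qed.

(** * Conditional law of the product given the past *)

Lemma past_measurable n : past Z n `<=` measurable.
Proof.
move=> E /past_cylinder; apply: g_sigma_algebra_measurable.
exact: cylinder_measurable.
Qed.

(* The bound F <= 1 keeps the measures E |-> \int_E F(Z_n, W_n) dP finite, as
   uniqueness on the pi-system generating past Z n.+1 requires. *)
Definition conditional_law n : Prop :=
  forall (E : set T) (F : R * R -> \bar R), past Z n E -> measurable_fun setT F ->
    (forall z, 0 <= F z)%E -> (forall z, F z <= 1)%E ->
  (\int[P]_(w in E) F (Z n w, W n w) =
   \int[P]_(w in E) cond_expect lambda a F (Z n w))%E.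

(** Integrate out gamma_n, which is independent of the past, then W_n by the conditional law at time
    n, then change variables. This serves both the induction on n and the Markov property. *)
Lemma conditional_law_next n (E : set T) (F : R * R -> \bar R) : (0 < n)%N ->
  conditional_law n -> past Z n E -> measurable_fun setT F ->
  (forall z, 0 <= F z)%E -> (forall z, F z <= 1)%E ->
  (\int[P]_(w in E) F (Z n.+1 w, W n.+1 w) =
   \int[P]_(w in E `&` Z n @^-1` Rpos R)
     \int[leb]_(y in Rpos R)
       ((Qdensity lambda a (Z n w) y)%:E * cond_expect lambda a F y))%E.
Proof.
move=> n0 IH nE mF F0 F1.
have mE := past_measurable nE.
pose Tc := g_sigma_algebraType (cylinder gamma n).
have mZc : measurable_fun setT (Z n : Tc -> R).
  by apply: measurable_Zproc => i ni; exact: measurable_gamma_cylinder.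
have mWc : measurable_fun setT (W n : Tc -> R).
  by apply: measurable_prefix_prod => i ni; exact: measurable_gamma_cylinder.
(* The recurrences write (Z_(n+1), W_(n+1)) through the past and gamma_n. The indicator of [E]
   belongs to the integrand because [E] depends on the past. *)
pose H (z : Tc * R) : \bar R :=
  ((\1_E z.1)%:E * F (z.2 * Z n z.1 + (W n z.1)^-1, W n z.1 * z.2)%R)%E.
have mH : measurable_fun setT H.
  have m1 : measurable_fun setT (@fst Tc R) by exact: measurable_fst.
  have m2 : measurable_fun setT (@snd Tc R) by exact: measurable_snd.
  have mZ1 := measurableT_comp mZc m1.
  have mW1 := measurableT_comp mWc m1.
  have mE1 : measurable_fun setT (\1_E : Tc -> R).
    by apply: measurable_indic; exact: (past_cylinder nE).
  apply: emeasurable_funM.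
    by apply/measurable_EFinP; exact: (measurableT_comp mE1 m1).
  apply: (measurableT_comp mF); apply: measurable_fun_pair.
    by apply: measurable_funD; [exact: measurable_funM|exact: measurable_funV].
  exact: measurable_funM.
have H0 z : (0 <= H z)%E by rewrite mule_ge0.
(* Mean of F(Z_(n+1), W_(n+1)) over gamma_n when (Z_n, W_n) = t; it stays between 0 and 1, so the
   induction hypothesis applies to it. *)
pose f (t : R * R) := (\int[leb]_(g in Rpos R)
     (F (g * t.1 + t.2^-1, t.2 * g)%R * (gd g)%:E))%E.
have gd1 : (\int[leb]_(g in Rpos R) (gd g)%:E = 1)%E.
  by rewrite -gig_total /gig setIid.
pose f' (z : (R * R) * R) :=
  (F (z.2 * z.1.1 + z.1.2^-1, z.1.2 * z.2)%R * (gd z.2)%:E)%E.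
have mf' : measurable_fun setT f'.
  have m1 : measurable_fun setT (@fst (R * R) R) by exact: measurable_fst.
  have m2 : measurable_fun setT (@snd (R * R) R) by exact: measurable_snd.
  have m11 := measurableT_comp (measurable_fst : measurable_fun setT (@fst R R)) m1.
  have m12 := measurableT_comp (measurable_snd : measurable_fun setT (@snd R R)) m1.
  apply: emeasurable_funM; last first.
    by apply/measurable_EFinP; exact: (measurableT_comp (measurable_gig_density _ _)).
  apply: (measurableT_comp mF); apply: measurable_fun_pair.
    by apply: measurable_funD; [exact: measurable_funM|exact: measurable_funV].
  exact: measurable_funM.
have f'0 z : (0 <= f' z)%E by rewrite mule_ge0// lee_fin gig_density_ge0.
have mf : measurable_fun setT f.
  exact: (@measurable_fun_integral_on _ _ _ _ _ leb _ mDpos f' mf' f'0).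
have f0 t : (0 <= f t)%E.
  by apply: integral_ge0 => g _; rewrite mule_ge0// lee_fin gig_density_ge0.
have f1 t : (f t <= 1)%E.
  rewrite -gd1; apply: ge0_le_integral => //.
  - by move=> g _; rewrite mule_ge0// lee_fin gig_density_ge0.
  - by apply: measurable_funTS; exact: (measurable_fun_pair2 t mf').
  - by apply/measurable_EFinP/measurable_funTS; exact: measurable_gig_density.
  - by move=> g _; rewrite -[leRHS]mul1e lee_wpmul2r// lee_fin gig_density_ge0.
transitivity (\int[P]_t H (t, gamma n t))%E.
  rewrite integral_mkcond; apply: eq_integral => t _.
  rewrite patchE /H/= indicE; case: ifP => _; rewrite ?mul1e ?mul0e//.
  by rewrite Zproc_recr big_nat_recr.
rewrite (@indep_integral _ _ _ _ _ _ (gamma n) (cylinder gamma n))//; last 4 first.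
- exact: cylinder_measurable.
- exact: cylinder_setI.
- exact: cylinder_setT.
- by move=> A B; exact: cylinder_indep.
transitivity (\int[P]_(t in E) f (Z n t, W n t))%E.
  rewrite [RHS]integral_mkcond; apply: eq_integral => t _.
  rewrite integral_gamma//; last exact: (measurable_fun_pair2 (t : Tc) mH).
  rewrite patchE /f /H/= indicE; case: ifP => _.
    by apply: eq_integral => g _; rewrite mul1e.
  by rewrite integral0_eq// => g _; rewrite !mul0e.
rewrite (IH E f nE mf f0 f1).
have mZpos : measurable (Z n @^-1` Rpos R).
  by rewrite -[X in measurable X]setTI; exact: mZ.
(* The change of variables needs Z_n > 0, which holds almost surely. *)
rewrite (integral_setI_full mE mZpos (Zproc_gt0_as n0)); last 2 first.
- by apply: (measurableT_comp _ (mZ n)); exact: measurable_cond_expect.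
- by move=> t; exact: cond_expect_ge0.
apply: eq_integral => t; rewrite inE => -[_]; rewrite /= in_itv/= andbT => Z0.
exact: transition_change_of_variables gig_mass_sqr_lty _ _ _ _ _.
Qed.

(** Z_1 is constant, so it generates the trivial sigma-algebra. *)
Lemma past1 E : past Z 1 E -> E = set0 \/ E = setT.
Proof.
apply: (@smallest_sub _ _ _ [set E | E = set0 \/ E = setT]) => /=.
  split => /=; first by left.
  - by move=> A [->|->]; rewrite setTD ?setC0 ?setCT; [right|left].
  - move=> F HF; have [[i Fi]|nF] := pselect (exists i, F i = setT); [right|left].
      by apply/seteqP; split => // t _; exists i => //; rewrite Fi.
    apply/seteqP; split => // t [i _]; case: (HF i) => Fi; first by rewrite Fi.
    by case: nF; exists i.
move=> _ [i /= /andP[i1 i2]] [B mB <-].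
have -> : i = 1%N by apply/eqP; rewrite eqn_leq i1 i2.
rewrite setTI; have [B1|B1] := pselect (B 1); [right|left].
  by apply/seteqP; split => // t _ /=; rewrite Zproc1.
by apply/seteqP; split => // t /=; rewrite Zproc1.
Qed.

Lemma conditional_law1 : conditional_law 1.
Proof.
move=> E F /past1[->|->] mF F0 F1; first by rewrite !integral_set0.
under eq_integral do rewrite Zproc1 big_nat1.
have Pcst (r : \bar R) : (\int[P]_(w in setT) r = r)%E.
  by rewrite integral_cst// [X in (_ * X)%E](@probability_setT _ _ _ P) mule1.
transitivity (cond_expect lambda a F 1); last first.
  by rewrite -[LHS]Pcst; apply: eq_integral => w _; rewrite Zproc1.
rewrite -(@ge0_integral_distribution _ _ _ _ _ _ (gamma 0) (fun x => F (1, x)))//;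
  last exact: measurable_fun_pair2.
rewrite integral_gamma//; last exact: measurable_fun_pair2.
by apply: eq_integral => x _; rewrite gig_density_cond.
Qed.

(** Both sides are finite measures in [E], so it suffices to compare them on a pi-system generating
    the past at time n+1. *)
Lemma conditional_lawS n : (0 < n)%N -> conditional_law n -> conditional_law n.+1.
Proof.
move=> n0 IH E F nE mF F0 F1.
have mK : measurable_fun setT (cond_expect lambda a F).
  exact: measurable_cond_expect.
have K0 y : (0 <= cond_expect lambda a F y)%E by exact: cond_expect_ge0.
have K1 y : (cond_expect lambda a F y <= 1)%E.
  by apply: cond_expect_le1 => //; exact: gig_mass_sqr_lty.
have mh1 : measurable_fun setT (fun w => F (Z n.+1 w, W n.+1 w)).
  by apply: (measurableT_comp mF); exact: (measurable_fun_pair (mZ _) (mW _)).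
have mh2 : measurable_fun setT (fun w => cond_expect lambda a F (Z n.+1 w)).
  exact: (measurableT_comp mK).
pose m1 : {measure set T -> \bar R} := density_measure P mh1 (fun=> F0 _).
pose m2 : {measure set T -> \bar R} := density_measure P mh2 (fun=> K0 _).
rewrite -[LHS]/(m1 E) -[RHS]/(m2 E).
(* The pi-system: an event of the past at time n intersected with a condition on Z_(n+1). Taking one
   of the two trivial gives every generator of the new past. *)
pose G := [set E' `&` Z n.+1 @^-1` A | E' in past Z n & A in measurable].
have mZA A : measurable A -> measurable (Z n.+1 @^-1` A).
  by move=> mA; rewrite -[X in measurable X]setTI; exact: mZ.
have ZTT : Z n.+1 @^-1` setT = setT by [].
have past_setI E1 E2 : past Z n E1 -> past Z n E2 -> past Z n (E1 `&` E2).
  pose Tp := g_sigma_algebraType (\bigcup_(i in [set i | (1 <= i <= n)%N])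
        preimage_set_system setT (Z i) measurable).
  exact: (@measurableI _ Tp).
have past_setT : past Z n setT.
  pose Tp := g_sigma_algebraType (\bigcup_(i in [set i | (1 <= i <= n)%N])
        preimage_set_system setT (Z i) measurable).
  exact: (@measurableT _ Tp).
have GE : past Z n.+1 `<=` <<s G >>.
  apply: smallest_sub; first exact: smallest_sigma_algebra.
  move=> S [i /= /andP[i1]]; rewrite leq_eqVlt => /predU1P[->|iN] [B mB <-].
    by apply: sub_sigma_algebra; exists setT => //; exists B.
  apply: sub_sigma_algebra; exists (setT `&` Z i @^-1` B).
    apply: sub_sigma_algebra; exists i; first by rewrite /= i1.
    by exists B.
  by exists setT => //; rewrite ZTT setIT.
apply: (g_sigma_algebra_measure_unique G _ (fun=> setT)) => //; last exact: GE.
- move=> _ [E' nE' [A mA <-]]; apply: measurableI; last exact: mZA.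
  exact: past_measurable nE'.
- by move=> _; exists setT => //; exists setT => //; rewrite ZTT setIT.
- by rewrite bigcup_const.
- move=> _ _ [E1 nE1 [A1 mA1 <-]] [E2 nE2 [A2 mA2 <-]].
  exists (E1 `&` E2); first exact: past_setI.
  by exists (A1 `&` A2); [exact: measurableI|rewrite setIACA].
- move=> _ [E' nE' [A mA <-]]; rewrite /m1 /m2/= /density_measure.
  have m1A : measurable_fun setT (EFin \o \1_A : R -> \bar R).
    by apply/measurable_EFinP; exact: measurable_indic.
  have mA1 : measurable_fun setT (fun t : R * R => (\1_A t.1)%:E : \bar R).
    exact: (measurableT_comp m1A measurable_fst).
  have I1 (x : R) : ((\1_A x)%:E <= 1 :> \bar R)%E.
    by rewrite lee_fin indicE; case: (_ \in _).
  (* The condition on Z_(n+1) moves into the integrand, and [conditional_law_next] applies to both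
     functions. *)
  pose F1A (t : R * R) : \bar R := ((\1_A t.1)%:E * F t)%E.
  pose F2A (t : R * R) : \bar R := ((\1_A t.1)%:E * cond_expect lambda a F t.1)%E.
  transitivity (\int[P]_(w in E') F1A (Z n.+1 w, W n.+1 w))%E.
    rewrite integral_mkcondr; apply: eq_integral => w _.
    rewrite patchE /F1A/= indicE.
    have -> : (w \in Z n.+1 @^-1` A) = (Z n.+1 w \in A) by apply/idP/idP; rewrite !inE.
    by case: ifP; rewrite ?mul1e ?mul0e.
  transitivity (\int[P]_(w in E') F2A (Z n.+1 w, W n.+1 w))%E; last first.
    rewrite integral_mkcondr; apply: eq_integral => w _.
    rewrite patchE /F2A/= indicE.
    have -> : (w \in Z n.+1 @^-1` A) = (Z n.+1 w \in A) by apply/idP/idP; rewrite !inE.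
    by case: ifP; rewrite ?mul1e ?mul0e.
  have F1A1 z : (F1A z <= 1)%E.
    apply: le_trans (F1 z); rewrite -[leRHS]mul1e lee_wpmul2r//.
  have F2A1 z : (F2A z <= 1)%E.
    apply: le_trans (K1 z.1); rewrite -[leRHS]mul1e lee_wpmul2r//.
  have F1A0 z : (0 <= F1A z)%E by rewrite mule_ge0.
  have F2A0 z : (0 <= F2A z)%E by rewrite mule_ge0.
  have mF1A : measurable_fun setT F1A by exact: emeasurable_funM.
  have mF2A : measurable_fun setT F2A.
    apply: (emeasurable_funM mA1).
    exact: (measurableT_comp mK measurable_fst).
  rewrite (conditional_law_next n0 IH nE' mF1A F1A0 F1A1).
  rewrite (conditional_law_next n0 IH nE' mF2A F2A0 F2A1).
  apply: eq_integral => w _; apply: eq_integral => y.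
  rewrite inE/= in_itv/= andbT => y0; congr (_ * _)%E.
  (* [F1A] and [F2A] have the same [cond_expect] at y: the indicator depends on y alone, and so does
     all of [F2A]. *)
  transitivity ((\1_A y)%:E * cond_expect lambda a F y)%E; last first.
    rewrite -(@cond_expect_fst _ lambda a a_gt0 gig_mass_sqr_lty
      (fun y => (\1_A y)%:E * cond_expect lambda a F y)%E)// mule_ge0//.
  rewrite /cond_expect -ge0_integralZl//.
  + by apply: eq_integral => v _; rewrite /F1A/= muleA.
  + by apply: measurable_funTS; exact: measurable_cond_expect_integrand.
  + by move=> v _; rewrite mule_ge0// lee_fin cond_density_ge0.
- move=> _; rewrite /m1/= /density_measure.
  apply: (@le_lt_trans _ _ (\int[P]_(w in setT) 1)%E); last first.
    by rewrite integral_cst// [X in (_ * X)%E](@probability_setT _ _ _ P) mule1 ltry.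
  by apply: ge0_le_integral => // w _; exact: F1.
Qed.

Lemma conditional_law_gt0 n : (0 < n)%N -> conditional_law n.
Proof.
case: n => // n _; elim: n => [|n IH]; first exact: conditional_law1.
exact: conditional_lawS.
Qed.

(** * The transition kernel and the Markov property *)

Let cond_expect1 x : 0 < x -> cond_expect lambda a (fun=> 1%E) x = 1%E.
Proof.
move=> x0.
exact: (@cond_expect_fst _ _ _ a_gt0 gig_mass_sqr_lty (fun=> 1%E) x x0 lee01).
Qed.

(** [transition_change_of_variables] with F = 1, where every density involved has mass 1. *)
Lemma integral_Qdensity x : 0 < x ->
  (\int[leb]_(y in Rpos R) (Qdensity lambda a x y)%:E = 1)%E.
Proof.
move=> x0; rewrite -[RHS](cond_expect1 x0).
transitivity (\int[leb]_(y in Rpos R)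
    ((Qdensity lambda a x y)%:E * cond_expect lambda a (fun=> 1) y))%E.
  apply: eq_integral => y; rewrite inE/= in_itv/= andbT => y0.
  by rewrite cond_expect1// mule1.
rewrite -(transition_change_of_variables a_gt0 gig_mass_sqr_lty)//.
rewrite /cond_expect; apply: eq_integral => v _; congr (_ * _)%E.
rewrite -[RHS]gig_total /gig setIid; apply: eq_integral => g _.
by rewrite mul1e.
Qed.

(** The cut-off makes the density nonnegative on the whole line, as [density_measure] requires. *)
Let h x y : \bar R := (Qdensity lambda a x y * \1_(Rpos R) y)%:E.

Let h0 x y : (0 <= h x y)%E.
Proof.
rewrite /h indicE lee_fin; case: (boolP (y \in Rpos R)) => [|_]; last first.
  by rewrite mulr0.
by rewrite inE/= in_itv/= andbT mulr1; exact: Qdensity_ge0.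
Qed.

Let mh : measurable_fun setT (fun t : R * R => h t.1 t.2).
Proof.
apply/measurable_EFinP; apply: measurable_funM; first exact: measurable_Qdensity.
exact: (measurableT_comp (measurable_indic mDpos) measurable_snd).
Qed.

Let QkernelE x A : measurable A ->
  Qkernel lambda a x A = (\int[leb]_(y in A) h x y)%E.
Proof.
move=> mA; rewrite /Qkernel integral_mkcondr; apply: eq_integral => y _.
by rewrite patchE /h indicE; case: ifP; rewrite ?mulr1 ?mulr0.
Qed.

Lemma Qkernel_transition_kernel : transition_kernel_on (Rpos R) (Qkernel lambda a).
Proof.
split=> [x|A mA].
  rewrite /= in_itv/= andbT => x0.
  have mhx : measurable_fun setT (h x : measurableTypeR R -> \bar R).
    exact: (measurable_fun_pair2 x mh).
  have mu1 : density_measure leb mhx (h0 x) setT = 1%E.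
    rewrite -[LHS](QkernelE x measurableT) /Qkernel setTI.
    exact: integral_Qdensity.
  pose mu : probability (measurableTypeR R) R :=
    HB.pack (density_measure leb mhx (h0 x))
    (Measure_isProbability.Build _ _ _ (density_measure leb mhx (h0 x)) mu1).
  (* The identity carries the measure from the display of Lebesgue measure to that of [R]. *)
  pose toR (y : measurableTypeR R) : R := y.
  have mtoR : measurable_fun setT toR by move=> _ B mB; rewrite setTI.
  pose toR' : {RV mu >-> R} :=
    HB.pack toR (isMeasurableFun.Build _ _ _ _ _ mtoR).
  exists (distribution mu toR'); last by move=> A mA; exact: QkernelE.
  rewrite -[LHS](QkernelE x mDpos) /Qkernel setIid.
  exact: integral_Qdensity.
apply: measurable_funTS.
rewrite (_ : (fun x => _) = fun x => (\int[leb]_(y in A) h x y)%E); last first.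
  by apply/funext => x; exact: QkernelE.
exact: (@measurable_fun_integral_on _ _ _ _ _ leb _ mA
  (fun t => h t.1 t.2) mh (fun t => h0 t.1 t.2)).
Qed.

(** [conditional_law_next] for the indicator of [A] in the first variable, which [cond_expect]
    leaves unchanged at y > 0. *)
Lemma Zproc_markov_property n E A : (0 < n)%N -> past Z n E -> measurable A ->
  (P (E `&` Z n.+1 @^-1` A) =
   \int[P]_(w in E `&` Z n @^-1` Rpos R) Qkernel lambda a (Z n w) A)%E.
Proof.
move=> n0 nE mA; have mE := past_measurable nE.
pose F (t : R * R) : \bar R := (\1_A t.1)%:E.
have mF : measurable_fun setT F.
  apply/measurable_EFinP.
  exact: (measurableT_comp (measurable_indic mA) measurable_fst).
have F0 t : (0 <= F t)%E by rewrite lee_fin indicE ler0n.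
have F1 t : (F t <= 1)%E by rewrite lee_fin indicE; case: (_ \in _).
have mZA : measurable (Z n.+1 @^-1` A).
  by rewrite -[X in measurable X]setTI; exact: mZ.
transitivity (\int[P]_(w in E) F (Z n.+1 w, W n.+1 w))%E.
  by rewrite setIC -integral_indic.
rewrite (conditional_law_next n0 (conditional_law_gt0 n0) nE mF F0 F1).
apply: eq_integral => w _; rewrite /Qkernel integral_mkcondl.
apply: eq_integral => y; rewrite inE/= in_itv/= andbT => y0.
rewrite (@cond_expect_fst _ lambda a a_gt0 gig_mass_sqr_lty
  (fun y => (\1_A y)%:E))//.
by rewrite patchE indicE; case: ifP; rewrite ?mule1 ?mule0.
Qed.

Lemma Zproc_homogeneous_markov_chain :
  homogeneous_markov_chain P (Rpos R) (Qkernel lambda a) Z.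
Proof.
split=> //.
- exact: Qkernel_transition_kernel.
- by move=> n n0; exact: Zproc_gt0_as.
- by move=> n n0 E A; exact: Zproc_markov_property.
Qed.

End chain.

Unset Implicit Arguments.

Theorem proposition3p3 (R : realType) (d : measure_display)
    (T : measurableType d) (P : probability T R) (a lambda : R)
    (gamma : nat -> {RV P >-> R})
    (a_gt0 : 0 < a)
    (gamma_indep : mutually_independent P (fun n => gamma n : T -> R))
    (gamma_law : forall (n : nat) (A : set R), measurable A ->
       distribution P (gamma n) A = gig lambda a A) :
  let Z := Zproc (fun n => gamma n : T -> R) in
  (forall w : T, Z 1%N w = 1) /\
  homogeneous_markov_chain P (`]0, +oo[ : set R) (Qkernel lambda a) Z.
Proof.
move=> Z; split; first exact: Zproc1.
exact: Zproc_homogeneous_markov_chain.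
Qed.
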